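(* Let $\Gamma$ be a nonempty index set, let $X$ be an $\mathcal{L}^\infty(\Gamma)$-type space, and let $Y$ be a real normed space. Suppose that $f:X\rightarrow Y$ is a surjective phase-isometry. Then $f$ is phase equivalent to a linear isometry.
   Context: A mapping $f: X\to Y$ between real normed spaces is a phase-isometry if $\{\|f(x)+f(y)\|, \|f(x)-f(y)\|\}=\{\|x+y\|, \|x-y\|\}$ (equality of unordered pairs) for all $x,y\in X$. No continuity or linearity is assumed. A mapping $f:X\to Y$ is phase equivalent to a linear isometry if there exists a function $\varepsilon: X\to\{-1,1\}$ such that the map $x\mapsto \varepsilon(x)f(x)$ is a linear isometry. $\ell^\infty(\Gamma)$ is the space of bounded real families $x=\{x_\gamma\}_{\gamma\in\Gamma}$ with norm $\|x\|=\sup_{\gamma\in\Gamma}|x_\gamma|$. An $\mathcal{L}^\infty(\Gamma)$-type space is a linear subspace of $\ell^\infty(\Gamma)$ (with the supremum norm) containing all the unit vectors $e_\gamma$, $\gamma\in\Gamma$, where $e_\gamma$ has $\gamma$-coordinate $1$ and all other coordinates $0$. *)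

(* Defs.v *)
From HB Require Import structures.
From mathcomp Require Import all_boot all_order all_algebra.
From mathcomp Require Import all_classical all_reals all_analysis.

Set Implicit Arguments.
Unset Strict Implicit.
Unset Printing Implicit Defensive.

Import Order.TTheory GRing.Theory Num.Theory.
Import numFieldNormedType.Exports.

Local Open Scope classical_set_scope.
Local Open Scope ring_scope.

(* [sup] is the real-valued supremum: it is meaningful here because it is only
   used for bounded families (and [sup set0 = 0] covers an empty index set). *)
Definition supnorm (R : realType) (Gamma : Type) (x : Gamma -> R) : R :=
  sup (range (fun g => `|x g|)).

Definition unit_vector (R : realType) (Gamma : Type) (g : Gamma) : Gamma -> R :=
  \1_[set g].

(* An L^oo(Gamma)-type space: a linear subspace of l^oo(Gamma) containing the
   unit vectors. Its elements form the type [Linf_elt X], whose algebraic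
   operations are the pointwise ones and whose norm is [supnorm]. *)
Record Linf_space (R : realType) (Gamma : Type) := LinfSpace {
  Linf_pred :> {pred (Gamma -> R)};
  Linf_submod : submod_closed Linf_pred;
  Linf_bounded : forall x, x \in Linf_pred -> bounded_fun x;
  Linf_unit : forall g, unit_vector R g \in Linf_pred
}.

HB.instance Definition _ (R : realType) (Gamma : Type) (X : Linf_space R Gamma) :=
  GRing.isSubmodClosed.Build R (Gamma -> R) (Linf_pred X) (Linf_submod X).

Record Linf_elt (R : realType) (Gamma : Type) (X : Linf_space R Gamma) :=
  LinfElt { Linf_val :> Gamma -> R; _ : Linf_val \in Linf_pred X }.

Section Linf_normed.
Context (R : realType) (Gamma : Type) (X : Linf_space R Gamma).

HB.instance Definition _ := [isSub for @Linf_val R Gamma X].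
HB.instance Definition _ := [Choice of Linf_elt X by <:].
HB.instance Definition _ := [SubChoice_isSubLmodule of Linf_elt X by <:].

Lemma Linf_has_ubound (x : Linf_elt X) : has_ubound (range (fun g => `|x g|)).
Proof.
have /Linf_bounded[M [_ /(_ (M + 1))]] := valP x.
rewrite ltrDl ltr01 => /(_ isT) xM.
by exists (M + 1) => _ [g _ <-]; exact: xM.
Qed.

Definition Linf_norm (x : Linf_elt X) : R := supnorm x.

Lemma le_Linf_norm (x : Linf_elt X) (g : Gamma) : `|x g| <= Linf_norm x.
Proof. by apply: ub_le_sup; [exact: Linf_has_ubound|exists g]. Qed.

Lemma Linf_norm_ge0 (x : Linf_elt X) : 0 <= Linf_norm x.
Proof.
have [[_ [g _ _]]|/nonemptyPn e] := pselect (range (fun g => `|x g|) !=set0).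
  exact: le_trans (le_Linf_norm x g).
by rewrite /Linf_norm /supnorm e sup0.
Qed.

Lemma Linf_norm_le (x : Linf_elt X) (M : R) :
  0 <= M -> (forall g, `|x g| <= M) -> Linf_norm x <= M.
Proof.
move=> M0 xM; have [[r rx]|/nonemptyPn e] :=
  pselect (range (fun g => `|x g|) !=set0).
  by apply: ge_sup; [exists r|move=> _ [g _ <-]; exact: xM].
by rewrite /Linf_norm /supnorm e sup0.
Qed.

Lemma Linf_normD (x y : Linf_elt X) : Linf_norm (x + y) <= Linf_norm x + Linf_norm y.
Proof.
apply: Linf_norm_le => [|g]; first by rewrite addr_ge0 ?Linf_norm_ge0.
by apply: le_trans (ler_normD _ _) _; rewrite lerD ?le_Linf_norm.
Qed.

Lemma Linf_normZ (l : R) (x : Linf_elt X) : Linf_norm (l *: x) = `|l| * Linf_norm x.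
Proof.
have le1 (k : R) (y : Linf_elt X) : Linf_norm (k *: y) <= `|k| * Linf_norm y.
  apply: Linf_norm_le => [|g]; first by rewrite mulr_ge0 ?Linf_norm_ge0.
  have -> : (k *: y) g = k * y g by [].
  by rewrite normrM ler_wpM2l ?le_Linf_norm.
have [->|l0] := eqVneq l 0.
  apply/eqP; rewrite eq_le le1/= normr0 mul0r.
  exact: Linf_norm_ge0.
apply/eqP; rewrite eq_le le1/= -ler_pdivlMl ?normr_gt0//.
by have := le1 l^-1 (l *: x); rewrite scalerA mulVf// scale1r normfV.
Qed.

Lemma Linf_norm0_eq0 (x : Linf_elt X) : Linf_norm x = 0 -> x = 0.
Proof.
move=> x0; apply/val_inj/funext => g.
by apply/eqP; rewrite -normr_le0 -x0; exact: le_Linf_norm.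
Qed.

HB.instance Definition _ := Lmodule_isNormed.Build R (Linf_elt X)
  Linf_normD Linf_normZ Linf_norm0_eq0.

Lemma Linf_addE (x y : Linf_elt X) (g : Gamma) : (x + y) g = x g + y g.
Proof. by []. Qed.

Lemma Linf_scaleE (l : R) (x : Linf_elt X) (g : Gamma) : (l *: x) g = l * x g.
Proof. by []. Qed.

Lemma Linf_normE (x : Linf_elt X) : `|x| = supnorm x.
Proof. by []. Qed.

End Linf_normed.

(* Unordered pairs are rendered as sets: {a, b} = {c, d} as sets iff (a, b) is
   (c, d) or (d, c). *)
Definition phase_isometry (R : realType) (X Y : normedModType R) (f : X -> Y) :=
  forall x y : X,
    [set `|f x + f y|; `|f x - f y|] = [set `|x + y|; `|x - y|].

Definition linear_isometry (R : realType) (X Y : normedModType R) (f : X -> Y) :=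
  linear f /\ forall x y : X, `|f x - f y| = `|x - y|.

Definition phase_equivalent_to_linear_isometry (R : realType)
    (X Y : normedModType R) (f : X -> Y) :=
  exists epsilon : X -> R,
    (forall x, epsilon x = -1 \/ epsilon x = 1) /\
    linear_isometry (fun x => epsilon x *: f x).

(* Main.v *)
(* For each index g, the image under f of the half-line spanned by e_g is, up to
   signs, a geodesic ray u in Y. By the phase-isometry identity its Busemann
   function b(y) = lim |y + u_t| - t is odd, besides being convex, hence it is a
   linear functional phi_g, and |phi_g (f x)| = |x_g| for all x. So f only changes
   signs of coordinates. Comparing x with t (e_g + e_h) for large t shows that
   phi_g (f x) phi_h (f x) = s_g s_h x_g x_h for fixed signs s; therefore
   (phi_g (f x))_g = +- (s_g x_g)_g with one sign for each x. *)

Require Import Defs.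
From HB Require Import structures.
From mathcomp Require Import all_boot all_order all_algebra.
From mathcomp Require Import all_classical all_reals all_analysis.
From mathcomp Require Import ring lra.

Set Implicit Arguments.
Unset Strict Implicit.
Unset Printing Implicit Defensive.

Import Order.TTheory GRing.Theory Num.Theory.
Import numFieldNormedType.Exports.

Local Open Scope classical_set_scope.
Local Open Scope ring_scope.

Lemma set2_eqP (T : Type) (a b c d : T) :
  [set a; b] = [set c; d] -> (a = c /\ b = d) \/ (a = d /\ b = c).
Proof.
move=> e.
have ha : [set c; d] a by rewrite -e; left.
have hb : [set c; d] b by rewrite -e; right.
have hc : [set a; b] c by rewrite e; left.
have hd : [set a; b] d by rewrite e; right.
by case: ha hb hc hd => [->|->] [->|->] [] ? [] ?; auto.
Qed.

(** * Linear functionals from Busemann functions *)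

(** Oddness gives [b 0 = 0], so affinity on segments from 0 gives homogeneity for scalars in [0, 1];
    inverses extend it to scalars above 1, oddness to negative ones. Additivity is affinity at the
    midpoint of [2 *: y] and [2 *: z]. *)
Lemma affine_odd_scalar (R : realFieldType) (V : lmodType R) (b : V -> R) :
  (forall y, b (- y) = - b y) ->
  (forall l y z, 0 <= l <= 1 -> b (l *: y + (1 - l) *: z) = l * b y + (1 - l) * b z) ->
  scalar b.
Proof.
move=> bN baff.
have b0 : b 0 = 0 by have := bN 0; rewrite oppr0; lra.
have bZ1 l y : 0 <= l <= 1 -> b (l *: y) = l * b y.
  by move=> l01; have := baff l y 0 l01; rewrite scaler0 addr0 b0 mulr0 addr0.
have bZp l y : 0 <= l -> b (l *: y) = l * b y.
  move=> l0; have [l1|l1] := leP l 1; first by rewrite bZ1// l0.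
  have lp : 0 < l by apply: lt_trans l1.
  have := @bZ1 l^-1 (l *: y); rewrite scalerA mulVf ?gt_eqF// scale1r => -> //.
    by rewrite mulrA divff ?mul1r// gt_eqF.
  by rewrite invr_ge0 l0 invf_le1// ltW.
have bZ l y : b (l *: y) = l * b y.
  have [/bZp//|l0] := leP 0 l.
  by rewrite -[l]opprK scaleNr bN bZp ?mulNr//; lra.
have half01 : 0 <= (2^-1 : R) <= 1 by apply/andP; split; lra.
have bD y z : b (y + z) = b y + b z.
  have -> : y + z = 2^-1 *: (2 *: y) + (1 - 2^-1) *: (2 *: z).
    by rewrite !scalerA; congr (_ + _); rewrite -[LHS]scale1r; congr (_ *: _); field.
  by rewrite baff// !bZ; field.
by move=> a y z; rewrite bD bZ.
Qed.

(* Busemann function of the ray [u]. Each [y |-> `|y + u t| - t] is convex and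
   nonincreasing in [t]; the hypothesis [hu] says that its values at [y] and
   [- y] eventually cancel, so both are eventually constant and the limit is
   convex and odd. *)
Lemma busemann_scalar (R : realType) (Y : normedModType R) (u : R -> Y) :
  (forall s t, 1 <= s -> s <= t -> `|u t - u s| <= t - s) ->
  (forall y, exists T, forall t, T <= t -> `|y + u t| + `|y - u t| = 2 * t) ->
  exists2 b : Y -> R, scalar b &
    forall y, exists T, forall t, T <= t -> `|y + u t| = t + b y.
Proof.
move=> ulip hu.
have mono y s t : 1 <= s -> s <= t -> `|y + u t| - t <= `|y + u s| - s.
  move=> s1 st.
  have -> : y + u t = (y + u s) + (u t - u s) by rewrite -addrA subrKC.
  by have := ler_normD (y + u s) (u t - u s); have := ulip s t s1 st; lra.
have normBC y t : `|y - u t| = `|- y + u t| by rewrite -normrN opprB addrC.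
have /choice[b bP] : forall y, exists b, exists T, forall t, T <= t ->
    `|y + u t| = t + b /\ `|y - u t| = t - b.
  move=> y; have [T0 hT0] := hu y; pose T := Num.max T0 1.
  have T0T : T0 <= T by rewrite le_max lexx.
  have T1 : 1 <= T by rewrite le_max lexx orbT.
  exists (`|y + u T| - T); exists T => t Tt.
  have := mono y T t T1 Tt; have := mono (- y) T t T1 Tt.
  rewrite -!normBC; have := hT0 T T0T; have := hT0 t (le_trans T0T Tt).
  by move=> *; split; lra.
have bN y : b (- y) = - b y.
  have [T1 h1] := bP y; have [T2 h2] := bP (- y).
  pose t := Num.max T1 T2.
  have [|_ e1] := h1 t; first by rewrite le_max lexx.
  have [|e2 _] := h2 t; first by rewrite le_max lexx orbT.
  by move: e1; rewrite normBC e2; lra.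
have bconv l y z : 0 <= l <= 1 -> b (l *: y + (1 - l) *: z) <= l * b y + (1 - l) * b z.
  move=> /andP[l0 l1]; set w := l *: y + _.
  have [T1 h1] := bP y; have [T2 h2] := bP z; have [T3 h3] := bP w.
  pose t := Num.max T1 (Num.max T2 T3).
  have [|e1 _] := h1 t; first by rewrite le_max lexx.
  have [|e2 _] := h2 t; first by rewrite !le_max lexx orbT.
  have [|e3 _] := h3 t; first by rewrite !le_max lexx !orbT.
  have wE : w + u t = l *: (y + u t) + (1 - l) *: (z + u t).
    by rewrite !scalerDr addrACA -scalerDl subrKC scale1r.
  have := ler_normD (l *: (y + u t)) ((1 - l) *: (z + u t)).
  rewrite -wE !normrZ e1 e2 e3 !ger0_norm//; last by rewrite subr_ge0.
  by move=> h; nra.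
exists b; last by move=> y; have [T h] := bP y; exists T => t /h[].
apply: affine_odd_scalar => // l y z l01; apply/eqP; rewrite eq_le bconv//=.
(* By oddness, convexity at the opposite points is the reverse inequality. *)
have := bconv l (- y) (- z) l01.
by rewrite !scalerN -opprD !bN; lra.
Qed.

(** * First consequences of the phase-isometry identity *)

Lemma phase_isometry_cases (R : realType) (X Y : normedModType R) (f : X -> Y) :
  phase_isometry f -> forall x y,
  (`|f x + f y| = `|x + y| /\ `|f x - f y| = `|x - y|) \/
  (`|f x + f y| = `|x - y| /\ `|f x - f y| = `|x + y|).
Proof. by move=> fP x y; exact: set2_eqP (fP x y). Qed.

(** On the diagonal the two pairs are {2|f x|, 0} and {2|x|, 0}; if they match crosswise, both norms
    vanish. *)
Lemma norm_phase_isometry (R : realType) (X Y : normedModType R) (f : X -> Y) :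
  phase_isometry f -> forall x, `|f x| = `|x|.
Proof.
move=> fP x; have := phase_isometry_cases fP x x.
rewrite !subrr -!mulr2n !normrMn !normr0 !mulr2n; lra.
Qed.

(** * Reading relative signs off norms, for abstract norming coordinates, so as to cover both [X]
    and [Y] *)

Section sign_test.
Context (R : realType) (Gamma : Type) (V : normedModType R) (phi : Gamma -> V -> R).
Hypothesis phi_scalar : forall g, scalar (phi g).
Hypothesis phi_le : forall g v, `|phi g v| <= `|v|.
Hypothesis phi_sup : forall v M, 0 <= M -> (forall g, `|phi g v| <= M) -> `|v| <= M.

Let phiD g v w : phi g (v + w) = phi g v + phi g w.
Proof. by rewrite -[v]scale1r phi_scalar mul1r scale1r. Qed.

(** At [g] and [h] the entry of [w] dominates that of [x], so the sum drops below [t] in absolute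
    value exactly when the signs are opposite; every other coordinate is at most |x| <= t/2. *)
Lemma norm_add_lt (g h : Gamma) (x w : V) (t : R) :
  phi g x != 0 -> phi h x != 0 -> 2 * `|x| <= t ->
  `|phi g w| = t -> `|phi h w| = t ->
  (forall i, i <> g -> i <> h -> phi i w = 0) ->
  (`|x + w| < t) = (phi g x * phi g w < 0) && (phi h x * phi h w < 0).
Proof.
move=> xg xh xt wg wh w0.
have coord i : phi i x != 0 -> `|phi i w| = t ->
    (`|phi i (x + w)| < t) = (phi i x * phi i w < 0).
  move=> x0 wt; rewrite phiD.
  have := phi_le i x; rewrite ler_norml => /andP[l1 l2].
  move: x0; rewrite neq_lt; case: (ger0P (phi i w)) wt => wi wt /orP[x0|x0].
  - by rewrite pmulr_llt0 ?x0; [rewrite ltr_norml; apply/andP; split|]; lra.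
  - by rewrite pmulr_rlt0// [RHS]ltNge wi/=; apply/negbTE; rewrite -leNgt ler_normr; lra.
  - rewrite nmulr_rlt0// [RHS]ltNge (ltW wi)/=; apply/negbTE.
    by rewrite -leNgt ler_normr; apply/orP; right; lra.
  - by rewrite pmulr_rlt0// wi ltr_norml; apply/andP; split; lra.
rewrite -!coord//.
apply/idP/andP => [xw|[lg lh]]; first by split; apply: le_lt_trans xw; exact: phi_le.
(* Coordinatewise strict bounds need not survive a supremum; a single bound [M < t] does. *)
pose M := Num.max (t / 2) (Num.max `|phi g (x + w)| `|phi h (x + w)|).
apply: (@le_lt_trans _ _ M); last first.
  by rewrite !gt_max lg lh !andbT; have := normr_ge0 (phi g (x + w)); lra.
apply: phi_sup => [|i]; first by rewrite !le_max normr_ge0 orbT.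
have [->|ig] := pselect (i = g); first by rewrite !le_max lexx orbT.
have [->|ih] := pselect (i = h); first by rewrite !le_max lexx !orbT.
rewrite le_max phiD w0// addr0; apply/orP; left.
by have := phi_le i x; lra.
Qed.

(* A vector [w] supported on [{g, h}] with two large equal entries detects, through
   norms alone, whether the signs of [x] at [g] and [h] agree up to those of [w]. *)
Lemma norm_add_sub_lt (g h : Gamma) (x w : V) (t : R) :
  phi g x != 0 -> phi h x != 0 -> 2 * `|x| <= t ->
  `|phi g w| = t -> `|phi h w| = t ->
  (forall i, i <> g -> i <> h -> phi i w = 0) ->
  (`|x + w| < t) || (`|x - w| < t) = (0 < (phi g x * phi g w) * (phi h x * phi h w)).
Proof.
move=> xg xh xt wg wh w0.
have phiN i v : phi i (- v) = - phi i v.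
  have phi00 : phi i 0 = 0 by have := phiD i 0 0; rewrite addr0; lra.
  by have := phiD i v (- v); rewrite subrr phi00; lra.
(* [x + w] detects that both products are negative, [x - w] that both are positive. *)
rewrite (@norm_add_lt g h x w)// (@norm_add_lt g h x (- w)) ?phiN ?normrN//; last first.
  by move=> i ig ih; rewrite phiN w0// oppr0.
rewrite !mulrN !oppr_lt0.
have t0 : 0 < t.
  by have := phi_le g x; have : 0 < `|phi g x| by [rewrite normr_gt0]; lra.
have a0 : phi g x * phi g w != 0 by rewrite mulf_neq0// -normr_gt0 wg.
have b0 : phi h x * phi h w != 0 by rewrite mulf_neq0// -normr_gt0 wh.
move: (_ * _) (_ * _) a0 b0 => A B.
rewrite !neq_lt => /orP[a0|a0] /orP[b0|b0].
- by rewrite nmulr_rgt0// a0 b0.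
- by rewrite nmulr_rgt0// (lt_gtF a0) (lt_gtF b0) andbF.
- by rewrite pmulr_rgt0// (lt_gtF a0) (lt_gtF b0) andbF.
- by rewrite pmulr_rgt0// a0 b0 orbT.
Qed.

End sign_test.

(** * Coordinate functionals on [Y] *)

Section Linf_phase_isometry.
Context (R : realType) (Gamma : Type) (X : Linf_space R Gamma) (Y : normedModType R).
Variable f : Linf_elt X -> Y.
Hypothesis f_surj : forall y : Y, exists x : Linf_elt X, f x = y.
Hypothesis f_phase : phase_isometry f.

Definition Linf_unit_elt (g : Gamma) : Linf_elt X := LinfElt (Linf_unit X g).
Local Notation e := Linf_unit_elt.

Lemma Linf_unit_eltE g : e g g = 1.
Proof. by rewrite /= /unit_vector indicE mem_set. Qed.

Lemma Linf_unit_elt_neq g h : h <> g -> e g h = 0.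
Proof. by move=> hg; rewrite /= /unit_vector indicE memNset. Qed.

Lemma norm_unit g : `|e g| = 1.
Proof.
apply/eqP; rewrite eq_le; apply/andP; split.
  apply: Linf_norm_le => // h; have [->|hg] := pselect (h = g).
    by rewrite Linf_unit_eltE normr1.
  by rewrite Linf_unit_elt_neq// normr0.
by have := le_Linf_norm (e g) g; rewrite Linf_unit_eltE normr1.
Qed.

(** The entry at [g] is at least 2|x| - |x| = |x|, hence dominates all the others. *)
Lemma norm_add_far_unit (x : Linf_elt X) g t :
  2 * `|x| <= t -> `|x + t *: e g| = t + x g.
Proof.
move=> xt; have xg := le_Linf_norm x g; have := xg; rewrite ler_norml => /andP[l1 l2].
have xt' : 2 * Linf_norm x <= t by [].
have x0 := Linf_norm_ge0 x.
apply/eqP; rewrite eq_le; apply/andP; split.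
  apply: Linf_norm_le => [|h]; first by lra.
  have := le_Linf_norm x h; rewrite Linf_addE Linf_scaleE.
  have [->|hg] := pselect (h = g).
    by move=> _; rewrite Linf_unit_eltE mulr1 ger0_norm; lra.
  by rewrite Linf_unit_elt_neq// mulr0 addr0; lra.
have := le_Linf_norm (x + t *: e g) g.
by rewrite Linf_addE Linf_scaleE Linf_unit_eltE mulr1 ger0_norm; [|lra]; rewrite addrC.
Qed.

Lemma norm_sub_far_unit (x : Linf_elt X) g t :
  2 * `|x| <= t -> `|x - t *: e g| = t - x g.
Proof. by move=> xt; rewrite -normrN opprB addrC norm_add_far_unit ?normrN. Qed.

(* The signed images [u t = +- f (t *: e g)] can be chosen so that [u] is an
   isometric, possibly curved, ray; [b] is its Busemann function. *)
Lemma coordinate_functional g :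
  exists2 b : Y -> R, scalar b & forall x, `|b (f x)| = `|x g|.
Proof.
have : forall t : R, exists u, (1 <= t -> `|u - f (e g)| = t - 1) /\
    (u = f (t *: e g) \/ u = - f (t *: e g)).
  (* The sign is fixed by comparison with [f (e g)], the point at parameter 1; below 1 it is
     arbitrary. *)
  move=> t; have [t1|t1] := leP 1 t; last by exists (f (t *: e g)); split=> //; left.
  have te : `|t *: e g - e g| = t - 1.
    by rewrite -{2}[e g]scale1r -scalerBl normrZ norm_unit mulr1 ger0_norm ?subr_ge0.
  have := phase_isometry_cases f_phase (t *: e g) (e g); rewrite te.
  case=> [[_ h]|[h _]]; first by exists (f (t *: e g)); split=> //; left.
  exists (- f (t *: e g)); split=> [_|]; last by right.
  by rewrite -opprD normrN.
move=> /choice[u uP].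
have ucases x t : (`|f x + u t| = `|x + t *: e g| /\ `|f x - u t| = `|x - t *: e g|) \/
    (`|f x + u t| = `|x - t *: e g| /\ `|f x - u t| = `|x + t *: e g|).
  have [_ uE] := uP t; have := phase_isometry_cases f_phase x (t *: e g).
  by case: uE => ->; rewrite ?opprK; tauto.
have [||b blin bP] := @busemann_scalar R Y u.
- move=> s t s1 st.
  (* The phase identity allows only the distances [t - s] and [t + s]; the detour through [f (e g)]
     is shorter than [t + s]. *)
  have h1 : `|u t - u s| <= (t - 1) + (s - 1).
    have [ut _] := uP t; have [us _] := uP s.
    rewrite -ut ?(le_trans s1)// -us// -[`|u s - _|]normrN opprB.
    by apply: le_trans (ler_normD _ _); rewrite addrA subrK.
  have h2 : `|t *: e g + s *: e g| = t + s.
    by rewrite -scalerDl normrZ norm_unit mulr1 ger0_norm; lra.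
  have h3 : `|t *: e g - s *: e g| = t - s.
    by rewrite -scalerBl normrZ norm_unit mulr1 ger0_norm; lra.
  have [_ uE] := uP t.
  have := ucases (t *: e g) s; rewrite h2 h3.
  case: uE h1 => ->; first by lra.
  by rewrite -opprD normrN; lra.
(* For [t >= 2|x|] the two norms are [t + x g] and [t - x g] in some order. *)
- move=> y; have [x <-] := f_surj y; exists (2 * `|x|) => t xt.
  by have := ucases x t; rewrite norm_add_far_unit// norm_sub_far_unit//; lra.
exists b => // x; have [T hT] := bP (f x).
pose t := Num.max T (2 * `|x|).
have := hT t; have := ucases x t.
rewrite norm_add_far_unit ?norm_sub_far_unit ?le_max ?lexx ?orbT// => h /(_ isT) h'.
have [->|->] : b (f x) = x g \/ b (f x) = - x g by lra.
  by [].
by rewrite normrN.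
Qed.

(** * Coherence of the coordinate signs *)

Section coordinates.
Variable phi : Gamma -> Y -> R.
Hypothesis phi_scalar : forall g, scalar (phi g).
Hypothesis phi_f : forall g x, `|phi g (f x)| = `|x g|.

Lemma coord_le g y : `|phi g y| <= `|y|.
Proof.
by have [x <-] := f_surj y; rewrite phi_f (norm_phase_isometry f_phase) le_Linf_norm.
Qed.

Lemma coord_sup y M : 0 <= M -> (forall g, `|phi g y| <= M) -> `|y| <= M.
Proof.
have [x <-] := f_surj y => M0 xM; rewrite (norm_phase_isometry f_phase).
by apply: Linf_norm_le => // g; rewrite -phi_f.
Qed.

Lemma coord_eq0 g x : (phi g (f x) == 0) = (x g == 0).
Proof. by rewrite -normr_eq0 phi_f normr_eq0. Qed.

(** The phase identity preserves the unordered pair |x + w|, |x - w|, so the sign test has the same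
    outcome in [X] and in [Y]: both products are positive or neither is. Their absolute values agree
    by [phi_f]. *)
Lemma coord_mul_far g h (x : Linf_elt X) t : g <> h -> x g != 0 -> x h != 0 -> 2 * `|x| <= t ->
  let w := t *: (e g + e h) in
  (phi g (f x) * phi g (f w)) * (phi h (f x) * phi h (f w)) = (x g * t) * (x h * t).
Proof.
move=> gh xg xh xt w.
have wg : w g = t.
  by rewrite Linf_scaleE Linf_addE Linf_unit_eltE Linf_unit_elt_neq// addr0 mulr1.
have wh : w h = t.
  by rewrite Linf_scaleE Linf_addE Linf_unit_eltE Linf_unit_elt_neq ?add0r ?mulr1//; exact: nesym.
have wi i : i <> g -> i <> h -> w i = 0.
  by move=> ig ih; rewrite Linf_scaleE Linf_addE !Linf_unit_elt_neq// addr0 mulr0.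
have t0 : 0 <= t by apply: le_trans xt; rewrite mulr_ge0.
have tE : `|t| = t by rewrite ger0_norm.
have SX := @norm_add_sub_lt R Gamma (Linf_elt X) (fun g (x : Linf_elt X) => x g) (fun _ _ _ _ => erefl)
  (fun g x => le_Linf_norm x g) (@Linf_norm_le R Gamma X) g h x w t xg xh xt.
have SY := @norm_add_sub_lt R Gamma Y phi phi_scalar coord_le coord_sup g h (f x) (f w) t.
rewrite !coord_eq0 (norm_phase_isometry f_phase) !phi_f wg wh in SY.
rewrite wg wh in SX.
have eqlt : (`|f x + f w| < t) || (`|f x - f w| < t) = (`|x + w| < t) || (`|x - w| < t).
  by case: (phase_isometry_cases f_phase x w) => -[-> ->]//; rewrite orbC.
have : `|phi g (f x) * phi g (f w) * (phi h (f x) * phi h (f w))| = `|x g * t * (x h * t)|.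
  by rewrite !normrM !phi_f wg wh.
have : (0 < phi g (f x) * phi g (f w) * (phi h (f x) * phi h (f w))) = (0 < x g * t * (x h * t)).
  rewrite -SX// -SY// => i ig ih.
  by apply/eqP; rewrite coord_eq0 wi.
move: (phi g _ * _ * _) (x g * t * _) => A B; case: (ltrP 0 A) => A0 /esym.
  by move=> B0; rewrite !gtr0_norm.
by move/negbT; rewrite -leNgt => B0; rewrite !ler0_norm// => /oppr_inj.
Qed.

(** The ratio of [phi g (f x) * phi h (f x)] to [x g * x h] does not depend on [x];
    cross-multiplication admits zero coordinates. *)
Lemma coord_mul_proportional g h (x y : Linf_elt X) :
  phi g (f x) * phi h (f x) * (y g * y h) = phi g (f y) * phi h (f y) * (x g * x h).
Proof.
have sq (z : Linf_elt X) k : phi k (f z) * phi k (f z) = z k * z k.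
  by rewrite -!expr2 -real_normK ?num_real// phi_f real_normK ?num_real.
have [<-|gh] := pselect (g = h); first by rewrite !sq mulrC.
have zero (z : Linf_elt X) k : z k = 0 -> phi k (f z) = 0 by move=> z0; apply/eqP; rewrite coord_eq0 z0.
have [xg|xg] := eqVneq (x g) 0; first by rewrite xg (zero x g)// !(mul0r, mulr0).
have [xh|xh] := eqVneq (x h) 0; first by rewrite xh (zero x h)// !(mul0r, mulr0).
have [yg|yg] := eqVneq (y g) 0; first by rewrite yg (zero y g)// !(mul0r, mulr0).
have [yh|yh] := eqVneq (y h) 0; first by rewrite yh (zero y h)// !(mul0r, mulr0).
(* Large enough for one far vector [w] to serve both [x] and [y]; its unknown factor [C] then
   cancels. *)
pose t : R := 2 * (`|x| + `|y|).
have x0 : 0 < `|x|.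
  by apply: lt_le_trans (le_Linf_norm x g); rewrite normr_gt0.
have y0 := normr_ge0 y.
have t0 : t != 0 by rewrite gt_eqF// /t; lra.
have hx : 2 * `|x| <= t by rewrite /t; lra.
have hy : 2 * `|y| <= t by rewrite /t; lra.
have := coord_mul_far gh xg xh hx; have := coord_mul_far gh yg yh hy.
set w := t *: _ => /= ey ex.
pose C := phi g (f w) * phi h (f w).
have ey' : phi g (f y) * phi h (f y) * C = y g * y h * t ^+ 2.
  by transitivity (y g * t * (y h * t)); [rewrite -ey /C|]; ring.
have ex' : phi g (f x) * phi h (f x) * C = x g * x h * t ^+ 2.
  by transitivity (x g * t * (x h * t)); [rewrite -ex /C|]; ring.
have C0 : C != 0.
  apply: contra_neq (mulf_neq0 (mulf_neq0 xg xh) (expf_neq0 2 t0)) => C0.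
  by rewrite -ex' C0 mulr0.
apply: (mulIf C0).
apply: (mulIf (expf_neq0 2 t0)).
transitivity ((phi g (f x) * phi h (f x) * C) * (y g * y h * t ^+ 2)); first by ring.
by rewrite ex' -ey'; ring.
Qed.

(** Iterated from a unit vector, this gives elements equal to 1 at several prescribed indices,
    whether or not these coincide. *)
Lemma update_to_one (x : Linf_elt X) g :
  exists z : Linf_elt X, z g = 1 /\ forall h, x h = 1 -> z h = 1.
Proof.
have [xg|xg] := eqVneq (x g) 1; first by exists x.
exists (x + (1 - x g) *: e g); split.
  by rewrite Linf_addE Linf_scaleE Linf_unit_eltE mulr1 subrKC.
move=> h xh; rewrite Linf_addE Linf_scaleE Linf_unit_elt_neq ?mulr0 ?addr0//.
by move=> hg; move: xg; rewrite -hg xh eqxx.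
Qed.

Lemma coord_sign : [set: Gamma] !=set0 -> exists s : Gamma -> R,
  forall x : Linf_elt X, exists2 ep, ep = -1 \/ ep = 1 & forall g, phi g (ep *: f x) = s g * x g.
Proof.
move=> [g0 _].
(* [s g] is the sign at [g] relative to the base index [g0]. *)
have /choice[s sP] : forall g, exists s, forall x : Linf_elt X,
    phi g0 (f x) * phi g (f x) = s * (x g0 * x g).
  move=> g; have [v [vg vg0]] := update_to_one (e g0) g.
  have {}vg0 := vg0 g0 (Linf_unit_eltE g0).
  exists (phi g0 (f v) * phi g (f v)) => x.
  by rewrite -coord_mul_proportional vg vg0 !mulr1.
have sq (z : Linf_elt X) k : phi k (f z) ^+ 2 = z k ^+ 2.
  by rewrite -real_normK ?num_real// phi_f real_normK ?num_real.
(* Evaluated at a [z] equal to 1 at [g0], [g] and [h]: in [s g * s h] the factor at [g0] appears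
   squared, hence equals 1. *)
have mulE g h (x : Linf_elt X) : phi g (f x) * phi h (f x) = s g * s h * (x g * x h).
  have [v [vg vg0]] := update_to_one (e g0) g.
  have {}vg0 := vg0 g0 (Linf_unit_eltE g0).
  have [z [zh z1]] := update_to_one v h.
  have zg := z1 _ vg; have zg0 := z1 _ vg0.
  have := coord_mul_proportional g h x z; rewrite zg zh !mulr1 => ->.
  have := sP g z; have := sP h z; rewrite zg zg0 zh !mulr1 => <- <-.
  by rewrite [X in _ = X * _]mulrACA -expr2 sq zg0 expr1n mul1r.
exists s => x.
have phiZ k a y : phi k (a *: y) = a * phi k y.
  by rewrite -[a *: y]addr0 phi_scalar; have := phi_scalar k 1 0 0;
     rewrite scaler0 addr0 mul1r; lra.
have [x0|/existsNP[h /eqP xh]] := pselect (forall h, x h = 0).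
  exists 1; first by right.
  by move=> g; rewrite phiZ mul1r x0 mulr0; apply/eqP; rewrite coord_eq0 x0.
have sh : s h ^+ 2 = 1.
  have := mulE h h x; rewrite -!expr2 sq => /esym.
  by rewrite -[RHS]mul1r => /mulIf; apply; rewrite expf_neq0.
have sh0 : s h != 0.
  by apply: contra_eq_neq sh => ->; rewrite expr0n /= eq_sym oner_neq0.
have sx0 : s h * x h != 0 by rewrite mulf_neq0.
(* The sign of [x] is read at one nonzero coordinate [h]; [mulE] carries it to all the others. *)
exists (phi h (f x) / (s h * x h)).
  have : (phi h (f x) / (s h * x h)) ^+ 2 = 1.
    by rewrite expr_div_n sq exprMn sh mul1r divff// expf_neq0.
  by move/eqP; rewrite sqrf_eq1 => /orP[] /eqP ->; auto.
by move=> g; rewrite phiZ mulrAC mulE; field; rewrite sh0 xh.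
Qed.

End coordinates.
End Linf_phase_isometry.

(** * Assembling the linear isometry *)

Theorem theorem3p3 (R : realType) (Gamma : Type)
    (Gamma_nonempty : [set: Gamma] !=set0)
    (X : Linf_space R Gamma) (Y : normedModType R) (f : Linf_elt X -> Y)
    (f_surj : forall y : Y, exists x : Linf_elt X, f x = y)
    (f_phase : phase_isometry f) :
  phase_equivalent_to_linear_isometry f.
Proof.
have /choice[phi phiP] : forall g, exists b : Y -> R,
    scalar b /\ forall x, `|b (f x)| = `|x g|.
  by move=> g; have [b ? ?] := coordinate_functional f_surj f_phase g; exists b.
have phi_scalar g : scalar (phi g) by case: (phiP g).
have phi_f g x : `|phi g (f x)| = `|x g| by case: (phiP g).
have [s sP] := coord_sign f_surj f_phase phi_scalar phi_f Gamma_nonempty.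
have /choice[ep epP] : forall x, exists ep, (ep = -1 \/ ep = 1) /\
    forall g, phi g (ep *: f x) = s g * x g.
  by move=> x; have [a ? ?] := sP x; exists a.
have phiB g y z : phi g (y - z) = phi g y - phi g z.
  by rewrite addrC -scaleN1r phi_scalar mulN1r addrC.
(* The functionals separate points of [Y], so linearity can be checked on the coordinates
   [s g * x g]. *)
have sep y z : (forall g, phi g y = phi g z) -> y = z.
  move=> yz; apply/eqP; rewrite -subr_eq0 -normr_le0.
  by apply: (coord_sup f_surj f_phase phi_f) => // g; rewrite phiB yz subrr normr0.
have lin : linear (fun x => ep x *: f x).
  move=> a x y; apply: sep => g.
  have [_ ->] := epP (a *: x + y).
  rewrite phi_scalar; have [_ ->] := epP x; have [_ ->] := epP y.
  by rewrite Linf_addE Linf_scaleE; ring.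
exists ep; split; first by move=> x; case: (epP x).
split=> // x y.
(* Linearity reduces distances to norms, which [f] preserves. *)
have -> : ep x *: f x - ep y *: f y = ep (x - y) *: f (x - y).
  by have := lin (-1) y x; rewrite !scaleN1r ![- _ + _]addrC => ->.
rewrite normrZ (norm_phase_isometry f_phase).
by have [[->|->] _] := epP (x - y); rewrite ?normrN normr1 mul1r.
Qed.
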